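(* Let $D$ be a GMPD domain. Then the following assertions are equivalent: (a) the set $\mathcal{O}(D)$ of all overrings of $D$ is finite; (b) each chain of overrings of $D$ (with respect to inclusion) is finite; (c) $\operatorname{Spec}(D)$ is finite; (d) $\operatorname{Max}(D)$ is finite.
   Context: All rings are commutative unitary integral domains. For an integral domain $D$ with quotient field $K$, an overring of $D$ is a subring of $K$ containing $D$ (so $D$ and $K$ are overrings), and $\mathcal{O}(D)$ is the set of all overrings of $D$. $\operatorname{Spec}(D)$ and $\operatorname{Max}(D)$ denote the sets of prime and of maximal ideals of $D$. $D$ is h-local if each nonzero ideal of $D$ is contained in only finitely many maximal ideals and each nonzero prime ideal is contained in a unique maximal ideal. An MNI ideal of $D$ is an ideal of $D$ which is maximal (under inclusion) among the non-invertible ideals of $D$ (the zero ideal counts as non-invertible). $D$ is an MPD domain if it has a unique MNI ideal $Q$ and every nonzero non-invertible ideal of $D$ can be written as $JQ$ for some invertible ideal $J$ of $D$. $D$ is a GMPD domain (globalized multiplicatively pinched-Dedekind domain) if $D$ is h-local and the localization $D_M$ is an MPD domain for every maximal ideal $M$ of $D$. *)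

(* Defs.v *)
From HB Require Import structures.
From mathcomp Require Import all_boot all_order all_algebra.
From mathcomp Require Import all_classical.

Set Implicit Arguments.
Unset Strict Implicit.
Unset Printing Implicit Defensive.

Import GRing.Theory.
Local Open Scope classical_set_scope.
Local Open Scope ring_scope.

(* An integral domain is represented as a subring of its quotient field [K];
   its overrings and localizations are then subrings of the same field, and its
   ideals are subsets of [K]. Lemma [tofrac_domain_in] shows that every
   [idomainType] is covered. *)

Section Domains.

Variable K : fieldType.
Implicit Types A B I J M P Q : set K.

Definition is_subring A : Prop := GRing.subring_closed (mem A).

Definition domain_in A : Prop :=
  is_subring A /\
  (forall x : K, exists a b, [/\ A a, A b, b != 0 & x = a / b]).

Definition overrings A : set (set K) := [set B | is_subring B /\ A `<=` B].

Definition is_ideal A I : Prop :=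
  [/\ I `<=` A, I 0, forall x y, I x -> I y -> I (x + y)
    & forall a x, A a -> I x -> I (a * x)].

Definition is_prime A P : Prop :=
  [/\ is_ideal A P, P <> A
    & forall x y, A x -> A y -> P (x * y) -> P x \/ P y].

Definition is_maximal A M : Prop :=
  [/\ is_ideal A M, M <> A
    & forall J, is_ideal A J -> M `<=` J -> J = M \/ J = A].

Definition Spec A : set (set K) := [set P | is_prime A P].

Definition Max A : set (set K) := [set M | is_maximal A M].

Definition localization A P : set K :=
  [set x | exists a s, [/\ A a, A s, ~ P s & x = a / s]].

Definition ideal_mul I J : set K :=
  [set x | exists n (a b : 'I_n -> K),
     [/\ forall i, I (a i), forall i, J (b i) & x = \sum_(i < n) a i * b i]].

Definition ideal_inv A I : set K := [set x | forall y, I y -> A (x * y)].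

(* For the zero ideal [ideal_inv A I] is all of [K], the product is still zero,
   and hence the zero ideal is not invertible, even when [A] is a field. *)
Definition invertible_ideal A I : Prop :=
  is_ideal A I /\ ideal_mul I (ideal_inv A I) = A.

Definition MNI A Q : Prop :=
  [/\ is_ideal A Q, ~ invertible_ideal A Q
    & forall J, is_ideal A J -> ~ invertible_ideal A J -> Q `<=` J -> J = Q].

Definition MPD A : Prop :=
  exists Q, [/\ MNI A Q, forall Q', MNI A Q' -> Q' = Q
    & forall I, is_ideal A I -> I <> [set 0] -> ~ invertible_ideal A I ->
        exists2 J, invertible_ideal A J & I = ideal_mul J Q].

Definition h_local A : Prop :=
  (forall I, is_ideal A I -> I <> [set 0] ->
     finite_set [set M | Max A M /\ I `<=` M]) /\
  (forall P, Spec A P -> P <> [set 0] -> exists! M, Max A M /\ P `<=` M).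

Definition GMPD A : Prop :=
  h_local A /\ (forall M, Max A M -> MPD (localization A M)).

End Domains.

Lemma tofrac_domain_in (D : idomainType) :
  domain_in [set tofrac x | x in [set: D]].
Proof.
split.
  split=> [|u v|u v]; rewrite !inE.
  - by exists 1; rewrite ?rmorph1.
  - by move=> [x _ <-] [y _ <-]; exists (x - y); rewrite ?rmorphB.
  - by move=> [x _ <-] [y _ <-]; exists (x * y); rewrite ?rmorphM.
move=> x; exists (tofrac \n_(repr x)), (tofrac \d_(repr x)).
have d0 : tofrac \d_(repr x) != 0 by rewrite tofrac_eq0 denom_ratioP.
split; [by eexists|by eexists|by []|].
apply: (canRL (mulfK d0)); rewrite -{1}[x]reprK; unlock tofrac.
rewrite -[LHS]FracField.pi_mul; apply/eqP; rewrite FracField.equivf_def.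
rewrite /FracField.mulf /= !numden_Ratio ?mulf_neq0 ?oner_neq0 //.
1: by rewrite !mulr1 mulrC.
all: exact: denom_ratioP.
Qed.

(* Main.v *)
Require Import Defs.
From HB Require Import structures.
From mathcomp Require Import all_boot all_order all_algebra.
From mathcomp Require Import all_classical.
From mathcomp Require Import ring.

Set Implicit Arguments.
Unset Strict Implicit.
Unset Printing Implicit Defensive.

Import GRing.Theory.
Local Open Scope classical_set_scope.
Local Open Scope ring_scope.

(** The substance is that finitely many maximal ideals leave room for only finitely
    many overrings. An overring R of D is the intersection of its localizations RD_M
    ([overring_local_global]), and RD_M is an overring of D_M. So it is
    enough that a local MPD domain A has finitely many overrings, and in fact
    there are at most three, A, K and one more ring B ([local_MPD_overrings]).

    Invertible ideals of A are principal. Hence every nonzero ideal is xA or xQ, where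
    Q is the MNI ideal, and by clearing denominators every nonzero fractional
    A-submodule of K is a multiple of A or of Q ([pinched]). Two overrings that are
    multiples of each other are equal, so at most one overring B other than A
    is fractional. The dichotomy also gives a completeness property: a
    fractional module closed under division by a nonzero element of a proper ideal
    that can serve as Q is zero ([divisible_zero]), since neither xA nor xQ is so
    closed. This makes the rings in question archimedean, so that they have no
    overring besides themselves and K. Let M be the maximal ideal of A, which may
    be assumed nonzero.

    If M = mA is principal ([principal_nonunits_overrings]), then A is a discrete
    valuation ring or B = A[1/m] is one, and every overring other than A contains B.
    If M is not principal, then M = Q; consider B = (M : M)
    ([nonprincipal_nonunits_overrings]). If B = A, then A is a valuation ring with
    no proper overring except K. If not, B is a discrete valuation ring with maximal
    ideal M, an overring not contained in B is K, and one contained in B is fractional.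

    Conversely, suppose that there are infinitely many maximal ideals M_0, M_1, ....
    In an h-local domain the rings D_N for N other than M have a common element
    outside D_M ([h_local_independent]), so the intersections of the D_{M_i} with
    i >= n form an infinite chain of overrings. Finally P can be recovered from
    D_P, so there are at most as many prime ideals as overrings. *)

(** * Subrings and submodules of a field *)

Section Subrings.

Variable K : fieldType.
Implicit Types A B I J M N P Q R S W : set K.

Lemma is_subringP A :
  is_subring A <-> [/\ A 1, forall x y, A x -> A y -> A (x - y)
                     & forall x y, A x -> A y -> A (x * y)].
Proof.
split=> [[A1 AB AM]|[A1 AB AM]]; split.
- by move: A1; rewrite inE.
- by move=> x y Ax Ay; have := AB x y; rewrite !inE; apply.
- by move=> x y Ax Ay; have := AM x y; rewrite !inE; apply.
- by rewrite inE.
- by move=> x y; rewrite !inE; apply: AB.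
- by move=> x y; rewrite !inE; apply: AM.
Qed.

Lemma subring1 A : is_subring A -> A 1.
Proof. by case/is_subringP. Qed.

Lemma subringB A x y : is_subring A -> A x -> A y -> A (x - y).
Proof. by case/is_subringP=> _ + _; apply. Qed.

Lemma subringM A x y : is_subring A -> A x -> A y -> A (x * y).
Proof. by case/is_subringP=> _ _; apply. Qed.

Lemma subring0 A : is_subring A -> A 0.
Proof.
by move=> rA; rewrite -(subrr 1); apply: subringB => //; apply: subring1.
Qed.

Lemma subringN A x : is_subring A -> A x -> A (- x).
Proof.
by move=> rA Ax; rewrite -sub0r; apply: subringB => //; apply: subring0.
Qed.

Lemma subringD A x y : is_subring A -> A x -> A y -> A (x + y).
Proof.
by move=> rA Ax Ay; rewrite -[y]opprK; apply: subringB => //; apply: subringN.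
Qed.

Lemma subringX A x n : is_subring A -> A x -> A (x ^+ n).
Proof.
move=> rA Ax; elim: n => [|n IHn]; first by rewrite expr0; apply: subring1.
by rewrite exprS; apply: subringM.
Qed.

Definition submodule A W : Prop :=
  [/\ W 0, forall x y, W x -> W y -> W (x + y)
    & forall a x, A a -> W x -> W (a * x)].

Lemma ideal_submodule A I : is_ideal A I -> submodule A I.
Proof. by case. Qed.

Lemma submodule_ideal A W : W `<=` A -> submodule A W -> is_ideal A W.
Proof. by move=> WA [W0 WD WM]; split. Qed.

Lemma subring_submodule A B : is_subring B -> A `<=` B -> submodule A B.
Proof.
move=> rB AB; split=> [|x y Bx By|a x Aa Bx].
- exact: subring0.
- exact: subringD.
- by apply: subringM => //; apply: AB.
Qed.

Lemma subring_ideal A : is_subring A -> is_ideal A A.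
Proof. by move=> rA; apply: submodule_ideal => //; apply: subring_submodule. Qed.

Lemma ideal_sum A I n (f : 'I_n -> K) :
  is_ideal A I -> (forall i, I (f i)) -> I (\sum_(i < n) f i).
Proof.
by case=> _ I0 ID _ If; elim/big_ind: _ => //= i _; apply: If.
Qed.

Lemma idealB A I x y : is_subring A -> is_ideal A I ->
  I x -> I y -> I (x - y).
Proof.
move=> rA [_ _ ID IM] Ix Iy; apply: ID => //; rewrite -mulN1r; apply: IM => //.
by apply: subringN => //; apply: subring1.
Qed.

Lemma ideal_eq_ring A I : is_ideal A I -> I 1 -> I = A.
Proof.
move=> [IA _ _ IM] I1; apply/seteqP; split=> // a Aa.
by rewrite -[a]mulr1; apply: IM.
Qed.

Lemma ideal_nonzero A I : is_ideal A I -> I <> [set 0] ->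
  exists2 x, I x & x != 0.
Proof.
move=> [_ I0 _ _] In0; apply: contrapT => nx; apply: In0.
apply/seteqP; split=> [x Ix /=|_ /= ->] //.
by apply: contrapT => /eqP x0; apply: nx; exists x.
Qed.

Definition scale (x : K) W : set K := [set x * w | w in W].

Lemma scaleP x W z : x != 0 -> scale x W z <-> W (z / x).
Proof.
move=> x0; split=> [[w Ww <-]|Wz]; first by rewrite mulrC mulKf.
by exists (z / x) => //; rewrite mulrC divfK.
Qed.

Lemma mem_scale x W w : W w -> scale x W (x * w).
Proof. by exists w. Qed.

Lemma scale_self A x : is_subring A -> scale x A x.
Proof. by move=> rA; exists 1; [apply: subring1|rewrite mulr1]. Qed.

Lemma scaleA x y W : scale x (scale y W) = scale (x * y) W.
Proof.
apply/seteqP; split=> [_ [_ [w Ww <-] <-]|_ [w Ww <-]]; last first.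
  by rewrite -mulrA; do 2!apply: mem_scale.
by rewrite mulrA; apply: mem_scale.
Qed.

Lemma scale1 W : scale 1 W = W.
Proof.
apply/seteqP; split=> [_ [w Ww <-]|w Ww]; first by rewrite mul1r.
by rewrite -[w]mul1r; apply: mem_scale.
Qed.

Lemma scale_sym x V W : x != 0 -> V = scale x W -> W = scale x^-1 V.
Proof. by move=> x0 ->; rewrite scaleA mulVf // scale1. Qed.

Lemma scale_submodule A W x : submodule A W -> submodule A (scale x W).
Proof.
move=> [W0 WD WM]; split.
- by exists 0 => //; rewrite mulr0.
- by move=> _ _ [v Vv <-] [w Ww <-]; exists (v + w); [apply: WD|rewrite mulrDr].
- by move=> a _ Aa [w Ww <-]; exists (a * w); [apply: WM|rewrite mulrCA].
Qed.

Lemma principal_ideal A x : is_subring A -> A x -> is_ideal A (scale x A).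
Proof.
move=> rA Ax; apply: submodule_ideal; first by move=> _ [a Aa <-]; apply: subringM.
exact/scale_submodule/subring_submodule.
Qed.

(** A ring contains 1, so a scaling factor between two rings and its inverse
    lie in both of them. *)
Lemma scale_ring_eq R S x : is_subring R -> is_subring S -> x != 0 ->
  R = scale x S -> R = S.
Proof.
have half U V y : is_subring U -> is_subring V -> y != 0 ->
    U = scale y V -> U `<=` V.
  move=> rU rV y0 UV.
  have Uy : U y by rewrite UV; apply: scale_self.
  have Vy : V y.
    have : U (y * y) by apply: subringM.
    by rewrite {1}UV => /(scaleP _ _ y0); rewrite mulfK.
  by move=> z; rewrite UV => -[v Vv <-]; apply: subringM.
move=> rR rS x0 RS; apply/seteqP; split; first exact: half RS.
apply: (half _ _ x^-1) => //; first by rewrite invr_eq0.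
exact: scale_sym.
Qed.

(** * Units and local rings *)

Definition ring_unit A x : Prop := [/\ A x, A x^-1 & x != 0].

Definition nonunits A : set K := [set x | A x /\ ~ ring_unit A x].

Definition is_local A : Prop := is_ideal A (nonunits A).

Lemma ring_unit1 A : is_subring A -> ring_unit A 1.
Proof. by move=> rA; split; rewrite ?invr1 ?oner_neq0 //; apply: subring1. Qed.

Lemma nonunits1 A : is_subring A -> ~ nonunits A 1.
Proof. by move=> rA [_]; apply; apply: ring_unit1. Qed.

Lemma unit_or_nonunit A x : A x -> ring_unit A x \/ nonunits A x.
Proof.
by move=> Ax; have [|nx] := pselect (ring_unit A x); [left|right].
Qed.

Lemma proper_ideal_nonunits A I : is_subring A -> is_ideal A I -> I <> A ->
  I `<=` nonunits A.
Proof.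
move=> rA iI IA x Ix; have [Isub _ _ IM] := iI; split; first exact: Isub.
move=> [Ax Ax1 x0]; apply: IA; apply: ideal_eq_ring => //.
by rewrite -(mulVf x0); apply: IM.
Qed.

End Subrings.

(** * Rings with no proper overring except the field *)

Section Archimedean.

Variable K : fieldType.
Implicit Types A B I J M N P Q R S W : set K.

Lemma domain_inW A B : domain_in A -> is_subring B -> A `<=` B -> domain_in B.
Proof.
move=> [_ fA] rB AB; split=> // x; have [a [b [Aa Ab b0 xE]]] := fA x.
by exists a, b; split=> //; apply: AB.
Qed.

(** A strong form of the maximality of B among the proper subrings of K: for every
    r outside B, the field is the union of the modules r^n B. *)
Definition archimedean B : Prop :=
  forall r z, ~ B r -> exists n, B (z / r ^+ n).

Lemma archimedean_overring B R : archimedean B ->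
  is_subring R -> B `<=` R -> R = B \/ R = setT.
Proof.
move=> arB rR BR; have [RB|/existsNP[r /not_implyP[Rr Br]]] := pselect (R `<=` B).
  by left; apply/seteqP.
right; apply/seteqP; split=> // z _; have [n Bzn] := arB r z Br.
have r0 : r != 0.
  by apply/eqP => r0; have [k] := arB r 0 Br; rewrite mul0r -r0.
rewrite -(divfK (expf_neq0 n r0) z); apply: subringM => //; first exact: BR.
exact: subringX.
Qed.

Lemma power_factor B p b n : is_subring B -> p != 0 ->
  nonunits B `<=` scale p B -> B b -> ~ B (b / p ^+ n) ->
  exists k u, ring_unit B u /\ b = p ^+ k * u.
Proof.
move=> rB p0 nuB Bb; elim: n => [|n IHn]; first by rewrite expr0 divr1.
have [Bbn|/IHn //] := pselect (B (b / p ^+ n)).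
move=> Bbn1; exists n, (b / p ^+ n); split.
  have [//|/nuB/(scaleP _ _ p0) B'] := unit_or_nonunit Bbn.
  by case: Bbn1; rewrite exprSr invfM mulrA.
by rewrite mulrC divfK ?expf_neq0.
Qed.

(** A nonzero element of the maximal ideal pB is p^k u with u a unit, so the
    field K is B[1/p] and every element outside B has its inverse in pB. *)
Lemma dvr_archimedean B p : domain_in B -> p != 0 -> B p ->
  nonunits B `<=` scale p B ->
  (forall z, (forall n, B (z / p ^+ n)) -> z = 0) -> archimedean B.
Proof.
move=> [rB fB] p0 Bp nuB infB.
have fact b : B b -> b != 0 -> exists k u, ring_unit B u /\ b = p ^+ k * u.
  move=> Bb b0; have /existsNP[n] : ~ forall n, B (b / p ^+ n).
    by move/infB/eqP; apply/negP.
  exact: power_factor.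
have unitV u : ring_unit B u -> B u^-1 by case.
have unit0 u : ring_unit B u -> u != 0 by case.
move=> r z Br; have [a [b [Ba Bb b0 zE]]] := fB z.
have [l [v [uv bE]]] := fact b Bb b0.
have [c Bc rE] : exists2 c, B c & r^-1 = p * c.
  have [a' [b' [Ba' Bb' b'0 rE]]] := fB r.
  have a'0 : a' != 0.
    by apply/eqP => a'0; apply: Br; rewrite rE a'0 mul0r; apply: subring0.
  have [i [u [uu aE]]] := fact a' Ba' a'0.
  have [j [w [uw b'E]]] := fact b' Bb' b'0.
  have [u0 w0] := (unit0 _ uu, unit0 _ uw).
  have [le_ji|lt_ij] := leqP j i.
    case: Br; rewrite rE aE b'E -(subnK le_ji) exprD.
    have -> : p ^+ (i - j) * p ^+ j * u / (p ^+ j * w) = p ^+ (i - j) * (u * w^-1).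
      by field; rewrite w0 expf_neq0.
    apply: subringM => //; first exact: subringX.
    by apply: subringM => //; [case: uu|apply: unitV].
  exists (p ^+ (j - i.+1) * (w * u^-1)).
    apply: subringM => //; first exact: subringX.
    by apply: subringM => //; [case: uw|apply: unitV].
  have pj : p ^+ j = p ^+ (j - i.+1) * (p * p ^+ i) by rewrite -exprS -exprD subnK.
  rewrite rE aE b'E pj.
  by field; rewrite u0 w0 p0 !expf_neq0.
exists l; rewrite -exprVn rE exprMn zE bE.
have -> : a / (p ^+ l * v) * (p ^+ l * c ^+ l) = a * v^-1 * c ^+ l.
  by field; rewrite unit0 // expf_neq0.
by apply: subringM => //; [apply: subringM => //; apply: unitV|apply: subringX].
Qed.

(** Put c = 1/r. If no z c^n were in B, then B would contain all the inverses
    1/(z c^n), which forces 1/z = 0. *)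
Lemma valuation_archimedean B : is_subring B ->
  (forall x, B x \/ B x^-1) ->
  (forall c, B c -> c != 0 -> ~ B c^-1 ->
     forall z, (forall n, B (z / c ^+ n)) -> z = 0) -> archimedean B.
Proof.
move=> rB valB infB r z Br; have [Br1|Bc] := valB r; first by [].
have r0 : r != 0 by apply/eqP => r0; apply: Br; rewrite r0; apply: subring0.
apply: contrapT => nB; have Bz n : B (z^-1 / r^-1 ^+ n).
  have [Bn|] := valB (z / r ^+ n); first by case: nB; exists n.
  by rewrite exprVn invfM.
have z0 : z^-1 = 0.
  by apply: (infB r^-1) => //; rewrite ?invr_eq0 ?invrK.
apply: nB; exists 0%N; move/eqP: z0; rewrite invr_eq0 => /eqP ->.
by rewrite mul0r; apply: subring0.
Qed.

End Archimedean.

(** * Ideals of a local ring pinched at one ideal *)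

Section Pinched.

Variable K : fieldType.
Implicit Types A B I J M N P Q R S W : set K.

Definition fractional A W : Prop :=
  exists2 d, d != 0 & forall w, W w -> A (d * w).

Definition nonzero W : Prop := exists2 w, W w & w != 0.

(** The dichotomy satisfied by the ideals of a local MPD domain, extended to
    fractional modules. The scaling factor is then an arbitrary element of K,
    and so the dichotomy for N is also one for every multiple of N. *)
Definition pinched A N : Prop :=
  forall W, submodule A W -> fractional A W -> nonzero W ->
  (exists2 x, x != 0 & W = scale x A) \/ (exists2 x, x != 0 & W = scale x N).

(** For ideals the factor of N can be taken in A. This integrality is what
    excludes rings such as k[[X^2, X^3]], all of whose nonzero fractional ideals are
    multiples of the ring or of its maximal ideal. *)
Definition ideal_pinched A N : Prop :=
  forall I, is_ideal A I -> nonzero I ->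
  (exists2 x, x != 0 & I = scale x A) \/
  (exists x, [/\ A x, x != 0 & I = scale x N]).

Lemma ideal_pinchedW A N : ideal_pinched A N -> pinched A N.
Proof.
move=> piA W mW [d d0 dW] [w Ww w0].
have iI : is_ideal A (scale d W).
  by apply: submodule_ideal; [move=> _ [v Vv <-]; apply: dW|apply: scale_submodule].
have nI : nonzero (scale d W).
  by exists (d * w); [apply: mem_scale|apply: mulf_neq0].
have WE V x : scale d W = scale x V -> W = scale (d^-1 * x) V.
  by rewrite -scaleA => <-; rewrite scaleA mulVf // scale1.
have [[x x0 /WE WA]|[x [_ x0 /WE WN]]] := piA _ iI nI; [left|right].
  by exists (d^-1 * x) => //; rewrite mulf_neq0 ?invr_eq0.
by exists (d^-1 * x) => //; rewrite mulf_neq0 ?invr_eq0.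
Qed.

Lemma pinched_scale A N P x : x != 0 -> P = scale x N ->
  pinched A N -> pinched A P.
Proof.
move=> x0 PE piA W mW fW nW; have [|[y y0 ->]] := piA W mW fW nW; first by left.
right; exists (y / x); first by rewrite mulf_neq0 ?invr_eq0.
by rewrite PE scaleA divfK.
Qed.

Lemma fractionalS A V W : V `<=` W -> fractional A W -> fractional A V.
Proof. by move=> VW [d d0 dW]; exists d => // v /VW/dW. Qed.

(** Division by c would carry the generator of a principal module, or an element
    xc of xN, outside of the module. *)
Lemma divisible_zero A N c W : is_subring A -> is_ideal A N -> ~ N 1 ->
  pinched A N -> N c -> c != 0 -> submodule A W -> fractional A W ->
  (forall w, W w -> W (w / c)) -> forall w, W w -> w = 0.
Proof.
move=> rA [NA N0 ND NM] N1 piA Nc c0 mW fW divW w Ww.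
apply: contrapT => /eqP w0.
have [|[x x0 WE]|[x x0 WE]] := piA W mW fW; first by exists w.
  have : W (x / c) by apply: divW; rewrite WE; apply: scale_self.
  rewrite WE => /(scaleP _ _ x0); rewrite mulrAC divff // mul1r => Ac.
  by apply: N1; rewrite -(mulVf c0); apply: NM.
have : W (x * c / c) by apply: divW; rewrite WE; apply: mem_scale.
by rewrite mulfK // WE => /(scaleP _ _ x0); rewrite divff.
Qed.

(** The intersection of the c^n B is closed under division by c. *)
Lemma power_quotients_zero A N c B : is_subring A -> is_ideal A N -> ~ N 1 ->
  pinched A N -> N c -> c != 0 -> is_subring B -> A `<=` B -> fractional A B ->
  forall z, (forall n, B (z / c ^+ n)) -> z = 0.
Proof.
move=> rA iN N1 piA Nc c0 rB AB fB z Bz.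
pose W := [set z | forall n, B (z / c ^+ n)].
apply: (@divisible_zero A N c W) => //.
- split=> [n|x y Wx Wy n|a x Aa Wx n].
  + by rewrite mul0r; apply: subring0.
  + by rewrite mulrDl; apply: subringD; [|apply: Wx|apply: Wy].
  + by rewrite -mulrA; apply: subringM; [|apply: AB|apply: Wx].
- by apply: fractionalS fB => x Wx; have := Wx 0%N; rewrite expr0 divr1.
- by move=> w Ww n; rewrite -mulrA -invfM -exprS; apply: Ww.
Qed.

End Pinched.

(** * Invertible ideals of local rings and the MPD condition *)

Section LocalMPD.

Variable K : fieldType.
Implicit Types A B I J M N P Q R S W : set K.

Lemma principal_of_unit A I a b : is_subring A -> is_ideal A I -> I a ->
  (forall y, I y -> A (y * b)) -> ring_unit A (a * b) -> I = scale a A.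
Proof.
move=> rA [_ _ _ IM] Ia Ib [_ Aab ab0]; apply/seteqP.
split=> [y Iy|_ [x Ax <-]]; last by rewrite mulrC; apply: IM.
have [a0 b0] : a != 0 /\ b != 0.
  by move: ab0; rewrite mulf_eq0 negb_or => /andP.
exists (y * b * (a * b)^-1); first by apply: subringM => //; apply: Ib.
by field; apply/andP.
Qed.

(** If 1 is a sum of products a_i b_i in a local ring, one of them is a unit, and
    its a_i generates. *)
Lemma local_invertible_principal A I : is_subring A -> is_local A ->
  invertible_ideal A I -> exists x, [/\ I x, x != 0 & I = scale x A].
Proof.
move=> rA locA [iI IIV].
have [n [a [b [Ia Ib /esym sumE]]]] : ideal_mul I (ideal_inv A I) 1.
  by rewrite IIV; apply: subring1.
have Iab i y : I y -> A (y * b i) by rewrite mulrC; apply: Ib.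
have [i ui] : exists i, ring_unit A (a i * b i).
  apply: contrapT => nu; apply: (nonunits1 rA); rewrite -sumE.
  apply: (ideal_sum locA) => i; split; first exact: Iab.
  by move=> ui; apply: nu; exists i.
exists (a i); split=> //; last exact: (principal_of_unit rA iI (Ia i) (Iab i)).
by case: ui => _ _; rewrite mulf_eq0 negb_or => /andP[].
Qed.

Lemma ring_invertible A : is_subring A -> invertible_ideal A A.
Proof.
move=> rA; split; first exact: subring_ideal.
apply/seteqP; split=> [_ [n [a [b [Aa Ab ->]]]]|x Ax].
  apply: (ideal_sum (subring_ideal rA)) => i; rewrite mulrC.
  exact: Ab.
exists 1%N, (fun=> x), (fun=> 1); split=> [//|_ y Ay|].
  by rewrite mul1r.
by rewrite big_ord_recl big_ord0 addr0 mulr1.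
Qed.

Lemma ideal_mul_principal A Q x : is_subring A -> is_ideal A Q ->
  ideal_mul (scale x A) Q = scale x Q.
Proof.
move=> rA iQ; have [_ Q0 QD QM] := iQ.
apply/seteqP; split=> [_ [n [a [b [Ia Qb ->]]]]|_ [q Qq <-]].
  have [sc0 scD _] := scale_submodule x (ideal_submodule iQ).
  elim/big_ind: _ => // i _; have [c Ac <-] := Ia i; rewrite -mulrA.
  by apply: mem_scale; apply: QM.
exists 1%N, (fun=> x), (fun=> q); split=> //.
  by move=> _; exists 1; [apply: subring1|rewrite mulr1].
by rewrite big_ord_recl big_ord0 addr0.
Qed.

Lemma MPD_pinched A : is_subring A -> is_local A -> MPD A ->
  exists2 Q, MNI A Q & ideal_pinched A Q.
Proof.
move=> rA locA [Q [mQ _ factQ]]; exists Q => // I iI [w Iw w0].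
have In0 : I <> [set 0] by move=> I0; move: w0; rewrite I0 in Iw; rewrite Iw eqxx.
have [invI|ninvI] := pselect (invertible_ideal A I).
  by have [x [_ x0 IE]] := local_invertible_principal rA locA invI; left; exists x.
right; have [J invJ IE] := factQ I iI In0 ninvI.
have [x [Jx x0 JE]] := local_invertible_principal rA locA invJ.
exists x; split=> //; first by case: invJ => -[JA _ _ _] _; apply: JA.
by rewrite IE JE; apply: ideal_mul_principal => //; case: mQ.
Qed.

(** The maximal ideal is not invertible here, so the maximality of Q among the
    non-invertible ideals makes the two equal. *)
Lemma MNI_nonunits A Q : is_subring A -> is_local A -> MNI A Q ->
  (forall x, nonunits A <> scale x A) -> Q = nonunits A.
Proof.
move=> rA locA [iQ ninvQ maxQ] npr; symmetry; apply: maxQ => //.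
  by case/(local_invertible_principal rA locA) => x [_ _]; apply: npr.
apply: proper_ideal_nonunits => // QA; apply: ninvQ; rewrite QA.
exact: ring_invertible.
Qed.

(** * Principal maximal ideal *)

Lemma localize_element A m : is_subring A -> A m -> m != 0 ->
  let B := [set z | exists n, A (m ^+ n * z)] in
  [/\ is_subring B, A `<=` B & B m^-1].
Proof.
move=> rA Am m0 /=; split.
- apply/is_subringP; split=> [|x y [i Ax] [j Ay]|x y [i Ax] [j Ay]].
  + by exists 0%N; rewrite expr0 mul1r; apply: subring1.
  + exists (i + j)%N.
    have -> : m ^+ (i + j) * (x - y) =
        m ^+ j * (m ^+ i * x) - m ^+ i * (m ^+ j * y) by rewrite exprD; ring.
    by apply: subringB => //; apply: subringM => //; apply: subringX.
  + exists (i + j)%N.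
    have -> : m ^+ (i + j) * (x * y) = m ^+ i * x * (m ^+ j * y).
      by rewrite exprD; ring.
    exact: subringM.
- by move=> a Aa; exists 0%N; rewrite expr0 mul1r.
- by exists 1%N; rewrite expr1 divff //; apply: subring1.
Qed.

(** The dichotomy applied to the module A + rA is what compares an arbitrary
    element r of an overring with A. *)
Definition ring_span A r : set K :=
  [set z | exists a b, [/\ A a, A b & z = a + r * b]].

Lemma ring_spanP A r : domain_in A ->
  [/\ submodule A (ring_span A r), fractional A (ring_span A r),
     nonzero (ring_span A r), ring_span A r 1 & ring_span A r r].
Proof.
move=> [rA fA]; have A0 := subring0 rA; have A1 := subring1 rA.
have W1 : ring_span A r 1 by exists 1, 0; split; rewrite // mulr0 addr0.
split=> //; last by exists 0, 1; split; rewrite // mulr1 add0r.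
- split=> [|_ _ [a [b [Aa Ab ->]]] [c [d [Ac Ad ->]]]|c _ Ac [a [b [Aa Ab ->]]]].
  + by exists 0, 0; split; rewrite // mulr0 addr0.
  + by exists (a + c), (b + d); split; [apply: subringD|apply: subringD|ring].
  + by exists (c * a), (c * b); split; [apply: subringM|apply: subringM|ring].
- have [c [d [Ac Ad d0 rE]]] := fA r; exists d => // _ [a [b [Aa Ab ->]]].
  have -> : d * (a + r * b) = d * a + c * b by rewrite rE; field.
  by apply: subringD => //; apply: subringM.
- by exists 1; last exact: oner_neq0.
Qed.

(** With M = mA, let P be the intersection of the m^n A. If P = 0, then A is a
    discrete valuation ring. Otherwise P is not principal, because P = mP, so it
    may play the role of Q; then B = A[1/m] is a multiple of P, which makes it a
    discrete valuation ring with maximal ideal P. An overring R with an element r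
    outside A contains 1/m, and hence B: the module A + rA is either a multiple of P,
    which is closed under division by m, or xA with 1/x in mA. *)
Lemma principal_nonunits_overrings A Q m : domain_in A -> m != 0 ->
  nonunits A = scale m A -> pinched A Q ->
  exists B, overrings A `<=` [set A; B; setT].
Proof.
move=> domA m0 nuA piQ; have [rA _] := domA.
have num : nonunits A m by rewrite nuA; exists 1; [apply: subring1|rewrite mulr1].
have Am : A m by case: num.
have NAm : ~ A m^-1 by move=> Am1; case: num => _; apply.
pose P := [set z | forall n, A (z / m ^+ n)].
have PA : P `<=` A by move=> z /(_ 0%N); rewrite expr0 divr1.
have Pm z : P z -> P (z / m) by move=> Pz n; rewrite -mulrA -invfM -exprS; apply: Pz.
have iP : is_ideal A P.
  split=> // [n|x y Px Py n|a x Aa Px n].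
  - by rewrite mul0r; apply: subring0.
  - by rewrite mulrDl; apply: subringD; [|apply: Px|apply: Py].
  - by rewrite -mulrA; apply: subringM; [| |apply: Px].
have P1 : ~ P 1 by move=> /(_ 1%N); rewrite expr1 mul1r.
have mdiv_nonprincipal W x : x != 0 -> (forall w, W w -> W (w / m)) ->
    W <> scale x A.
  move=> x0 Wm WE; apply: NAm.
  have /Wm : W x by rewrite WE; exists 1; [apply: subring1|rewrite mulr1].
  by rewrite WE => /(scaleP _ _ x0); rewrite mulrAC divff // mul1r.
have [[q Pq q0]|P0] := pselect (nonzero P); last first.
  exists A => R [rR AR].
  have arA : archimedean A.
    apply: (dvr_archimedean domA m0 Am); first by rewrite nuA.
    by move=> z Pz; apply: contrapT => /eqP z0; apply: P0; exists z.
  by have [->|->] := archimedean_overring arA rR AR; [left; left|right].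
have piP : pinched A P.
  have fP : fractional A P.
    by exists 1; [apply: oner_neq0|move=> w /PA; rewrite mul1r].
  have nP : nonzero P by exists q.
  have [[x x0 PE]|[x x0 PE]] := piQ P (ideal_submodule iP) fP nP.
    by case: (mdiv_nonprincipal P x x0 Pm PE).
  exact: pinched_scale PE piQ.
pose B := [set z | exists n, A (m ^+ n * z)].
have [rB AB Bm1] := localize_element rA Am m0; rewrite -/B in rB AB Bm1.
have PB z b : P z -> B b -> P (z * b).
  move=> Pz [n Ab]; have Pzn : P (z / m ^+ n).
    elim: n {Ab} => [|n IHn]; first by rewrite expr0 divr1.
    by rewrite exprSr invfM mulrA; apply: Pm.
  have -> : z * b = m ^+ n * b * (z / m ^+ n) by field; apply: expf_neq0.
  by case: iP => _ _ _; apply.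
(* B is fractional because qB lies in P, and not a multiple of A because it is
   closed under division by m. *)
have fB : fractional A B by exists q => // b Bb; apply/PA/PB.
have [p Pp [p0 PE]] : exists2 p, P p & p != 0 /\ P = scale p B.
  have nB : nonzero B by exists 1; [apply: subring1|apply: oner_neq0].
  have [[x x0 BE]|[x x0 BE]] := piP B (subring_submodule rB AB) fB nB.
    by case: (mdiv_nonprincipal B x x0 _ BE) => // w Bw; apply: subringM.
  have PE := scale_sym x0 BE; exists x^-1; last by rewrite invr_eq0.
  by rewrite PE; exists 1; [apply: subring1|rewrite mulr1].
have arB : archimedean B.
  apply: (@dvr_archimedean _ B p) => //.
  - exact: domain_inW domA rB AB.
  - exact/AB/PA.
  - rewrite -PE => b [Bb nub]; have [n Ab] := Bb.
    have mn0 := expf_neq0 n m0; have bE : b = m ^+ n * b * m^-1 ^+ n.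
      by rewrite exprVn mulrAC divff // mul1r.
    have [Pb|/existsNP[k nPb]] := pselect (P (m ^+ n * b)).
      by rewrite bE; apply: PB => //; apply: subringX.
    have nuS : nonunits A `<=` scale m A by rewrite nuA.
    have [j [u [[Au Au1 u0] buE]]] := power_factor rA m0 nuS Ab nPb.
    case: nub; rewrite bE buE; split.
    + by rewrite -buE -bE.
    + have -> : (m ^+ j * u * m^-1 ^+ n)^-1 = m^-1 ^+ j * u^-1 * m ^+ n.
        by rewrite !exprVn !invfM invrK.
      apply: subringM => //; last by apply: AB; apply: subringX.
      by apply: subringM => //; [apply: subringX|apply: AB].
    + by rewrite !mulf_neq0 ?expf_neq0 ?invr_eq0.
  - exact: (power_quotients_zero rA iP P1 piP Pp p0 rB AB fB).
exists B => R [rR AR].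
have [RA|/existsNP[r /not_implyP[Rr nAr]]] := pselect (R `<=` A).
  by left; left; apply/seteqP.
suff Rm1 : R m^-1.
  have BR : B `<=` R.
    move=> b [n /AR Rb]; have -> : b = m^-1 ^+ n * (m ^+ n * b).
      by rewrite exprVn mulKf // expf_neq0.
    by apply: subringM => //; apply: subringX.
  by have [->|->] := archimedean_overring arB rR BR; [left; right|right].
have A1 := subring1 rA.
have [mW fW nW W1 Wr] := ring_spanP r domA.
set W := ring_span A r in mW fW nW W1 Wr.
have WR : W `<=` R.
  move=> _ [a [b [Aa Ab ->]]]; apply: subringD; [by []|exact: AR|].
  by apply: subringM => //; apply: AR.
have [[x x0 WE]|[x x0 WE]] := piP W mW fW nW; last first.
  apply: WR; move: W1; rewrite WE => /(scaleP _ _ x0) /Pm.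
  by rewrite mulrAC => /(scaleP _ _ x0); rewrite mul1r.
have Rx : R x by apply: WR; rewrite WE; exists 1; rewrite ?mulr1.
move: (W1); rewrite WE => /(scaleP _ _ x0); rewrite mul1r => Ax1.
have [[_ + _]|nux] := unit_or_nonunit Ax1.
  rewrite invrK => Ax; case: nAr.
  by move: Wr; rewrite WE => -[a Aa <-]; apply: subringM.
move: nux; rewrite nuA => /(scaleP _ _ m0) Axm.
have -> : m^-1 = x * (x^-1 / m) by rewrite mulVKf.
by apply: subringM => //; apply: AR.
Qed.

(** * Non-principal maximal ideal *)

(** If A + rA were yM, then M would have the two generators f = 1/y and g = r/y.
    Consider the ideal I = fM + gM, which is the square of M. It misses f, or M would
    be gA by Nakayama. If I = zA, then some product of two elements of M is
    z up to a unit, which makes M principal. If I = zM, then f/z multiplies M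
    into itself, hence lies in A; it is not in M because f is not in I,
    so it is a unit, and M = fA. *)
Lemma nonunits_not_ring_span A r y : domain_in A -> is_local A -> y != 0 ->
  (forall x, nonunits A <> scale x A) -> pinched A (nonunits A) ->
  (forall z, (forall u, nonunits A u -> nonunits A (z * u)) -> A z) ->
  ring_span A r <> scale y (nonunits A).
Proof.
move=> domA iM y0 npr piM mulA WE; have [rA _] := domA.
set M := nonunits A in iM npr piM mulA WE.
have [MA M0 MD MM] := iM; have M1 : ~ M 1 := nonunits1 rA.
have [_ _ _ W1 Wr] := ring_spanP r domA; rewrite WE in W1 Wr.
have Mf : M y^-1 by move/(scaleP _ _ y0): W1; rewrite mul1r.
have Mg : M (r / y) by move/(scaleP _ _ y0): Wr.
have f0 : y^-1 != 0 by rewrite invr_eq0.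
set f := y^-1 in Mf f0; set g := r / y in Mg.
have Mgen u : M u -> exists a b, [/\ A a, A b & u = f * a + g * b].
  move=> Mu; have : ring_span A r (y * u) by rewrite WE; apply: mem_scale.
  move=> [a [b [Aa Ab uE]]]; exists a, b; split=> //.
  by rewrite -[u](mulKf y0) uE /g /f; field.
pose I := [set z | exists u v, [/\ M u, M v & z = f * u + g * v]].
have mI : submodule A I.
  split=> [|_ _ [a [b [Ma Mb ->]]] [c [d [Mc Md ->]]]|c _ Ac [a [b [Ma Mb ->]]]].
  - by exists 0, 0; split; rewrite // !mulr0 addr0.
  - by exists (a + c), (b + d); split; [apply: MD|apply: MD|ring].
  - by exists (c * a), (c * b); split; [apply: MM|apply: MM|ring].
have IM u v : M u -> M v -> I (u * v).
  move=> /Mgen[a [b [Aa Ab ->]]] Mv; exists (a * v), (b * v).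
  by split; [apply: MM|apply: MM|ring].
have nI : nonzero I by exists (f * f); [apply: IM|apply: mulf_neq0].
have fI : fractional A I.
  exists 1; first exact: oner_neq0.
  move=> _ [u [v [Mu Mv ->]]]; rewrite mul1r.
  by apply: subringD => //; apply: subringM => //; apply: MA.
have nIf : ~ I f.
  move=> [u [v [Mu Mv fE]]]; apply: (npr g).
  have Au1 : A (1 - u) by apply: subringB; [|apply: subring1|apply: MA].
  have [[_ Au1V u10]|Mu1] := unit_or_nonunit Au1; last first.
    by case: M1; rewrite -(subrK u 1); apply: MD.
  have fgv : f = g * (v * (1 - u)^-1).
    apply: (mulIf u10); rewrite mulrBr mulr1 {1}fE mulrA divfK //; ring.
  apply/seteqP; split=> [w /Mgen[a [b [Aa Ab ->]]]|_ [a Aa <-]]; last first.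
    by rewrite mulrC; apply: MM.
  exists (v * (1 - u)^-1 * a + b); last by rewrite fgv; ring.
  by apply: subringD => //; do 2?apply: subringM => //; apply: MA.
have [[z z0 IE]|[z z0 IE]] := piM I mI fI nI.
  have prodM u v : M u -> M v -> M (u * v / z).
    move=> Mu Mv; have Az w : M w -> A (w * (v / z)).
      by move=> Mw; rewrite mulrA; apply/(scaleP _ _ z0); rewrite -IE; apply: IM.
    have [unit|] := unit_or_nonunit (Az u Mu); last by rewrite mulrA.
    by case: (npr u); apply: (principal_of_unit rA iM Mu Az).
  have [u [v [Mu Mv zE]]] : I z by rewrite IE; apply: scale_self.
  apply: M1; rewrite -(divff z0) {1}zE mulrDl.
  by apply: MD; apply: prodM.
have Afz : A (f * z^-1).
  apply: mulA => u Mu; rewrite mulrAC; apply/(scaleP _ _ z0).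
  by rewrite -IE; apply: IM.
have [unit|Mfz] := unit_or_nonunit Afz; last first.
  by apply: nIf; rewrite IE; apply/(scaleP _ _ z0).
apply: (npr f); apply: (principal_of_unit rA iM Mf _ unit) => w Mw.
apply: mulA => u Mu; rewrite mulrAC; apply/(scaleP _ _ z0).
by rewrite -IE; apply: IM.
Qed.

(** Every A + rA is principal, say xA, and one of the two elements 1/x and r/x of A
    is a unit because 1 is a combination of them. So A is a valuation ring. *)
Lemma self_multiplier_archimedean A : domain_in A -> is_local A ->
  (forall x, nonunits A <> scale x A) -> pinched A (nonunits A) ->
  (forall z, (forall u, nonunits A u -> nonunits A (z * u)) -> A z) ->
  archimedean A.
Proof.
move=> domA iM npr piM mulA; have [rA _] := domA.
have M1 := nonunits1 rA; have [_ _ MD MM] := iM.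
apply: valuation_archimedean => // [x|c Ac c0 Ac1].
  have [mW fW nW W1 Wx] := ring_spanP x domA.
  have [[y y0 WE]|[y y0 WE]] := piM _ mW fW nW; last first.
    by case: (nonunits_not_ring_span domA iM y0 npr piM mulA WE).
  move: W1; rewrite WE => /(scaleP _ _ y0); rewrite mul1r => Ay1.
  move: Wx; rewrite WE => /(scaleP _ _ y0) Axy.
  have [[_ + _]|My1] := unit_or_nonunit Ay1.
    by rewrite invrK => Ay; left; rewrite -(divfK y0 x); apply: subringM.
  have [[_ Ayx xy0]|Mxy] := unit_or_nonunit Axy.
    right; have -> : x^-1 = y^-1 * (x / y)^-1.
      by rewrite invfM invrK mulrC -mulrA mulfV ?mulr1.
    exact: subringM.
  have : ring_span A x y by rewrite WE; apply: scale_self.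
  move=> [a [b [Aa Ab yE]]]; case: M1.
  have -> : 1 = a * y^-1 + b * (x / y) by rewrite -(divff y0) {1}yE; ring.
  by apply: MD; apply: MM.
apply: (power_quotients_zero rA iM M1 piM _ c0 rA) => //.
  by split=> // -[].
by exists 1; [apply: oner_neq0|move=> w; rewrite mul1r].
Qed.

(** Let B = (M : M). If B <> A, then B is fractional and not principal over A, so
    it is a multiple of M and M = pB. For a nonunit b of B the ideal bM is aM
    with a in A, and a is not a unit of A, so b lies in aB, hence in M. Thus B is a
    discrete valuation ring with maximal ideal M, and the overrings of A
    inside B are fractional ideals, that is, multiples of A or of B. *)
Lemma nonprincipal_nonunits_overrings A : domain_in A -> is_local A ->
  (forall x, nonunits A <> scale x A) -> ideal_pinched A (nonunits A) ->
  exists B, overrings A `<=` [set A; B; setT].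
Proof.
move=> domA iM npr ipiM; have [rA _] := domA; have piM := ideal_pinchedW ipiM.
have M1 := nonunits1 rA; set M := nonunits A in iM npr ipiM piM M1.
have [MA M0 MD MM] := iM.
have [m Mm m0] : nonzero M.
  apply: contrapT => zM; apply: (npr 0); apply/seteqP; split=> [u Mu|_ [a _ <-]].
    exists 1; first exact: subring1.
    by rewrite mul0r; symmetry; apply: contrapT => /eqP u0; apply: zM; exists u.
  by rewrite mul0r.
pose B := [set z | forall u, M u -> M (z * u)]; exists B => R [rR AR].
have [BA|nBA] := pselect (B `<=` A).
  have arA : archimedean A by apply: self_multiplier_archimedean.
  by have [->|->] := archimedean_overring arA rR AR; [left; left|right].
have AB : A `<=` B by move=> a Aa u Mu; apply: MM.
have rB : is_subring B.
  apply/is_subringP; split=> [|x y Bx By u Mu|x y Bx By u Mu].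
  - by apply: AB; apply: subring1.
  - by rewrite mulrBl; apply: (idealB rA iM); [apply: Bx|apply: By].
  - by rewrite -mulrA; apply/Bx/By.
have nprB x : x != 0 -> B <> scale x A.
  by move=> x0 /(scale_ring_eq rB rA x0) BA; apply: nBA; rewrite BA.
have fB : fractional A B by exists m => // b Bb; rewrite mulrC; apply/MA/Bb.
have nB : nonzero B by exists 1; [apply: subring1|apply: oner_neq0].
have [[x x0 BE]|[x x0 BE]] := piM B (subring_submodule rB AB) fB nB.
  by case: (nprB x x0 BE).
have ME := scale_sym x0 BE; set p := x^-1 in ME.
have p0 : p != 0 by rewrite invr_eq0.
have Mp : M p by rewrite ME; apply: scale_self.
have nuB : nonunits B `<=` scale p B.
  move=> b [Bb nub]; have [->|/eqP b0] := pselect (b = 0).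
    by exists 0; [apply: subring0|rewrite mulr0].
  have ibM : is_ideal A (scale b M).
    apply: submodule_ideal; first by move=> _ [u Mu <-]; apply/MA/Bb.
    exact/scale_submodule/ideal_submodule.
  have nbM : nonzero (scale b M).
    by exists (b * m); [apply: mem_scale|apply: mulf_neq0].
  have bp0 : b * p != 0 by apply: mulf_neq0.
  have [[z z0 bME]|[a [Aa a0 bME]]] := ipiM _ ibM nbM.
    case: (nprB ((b * p)^-1 * z)); first by rewrite mulf_neq0 ?invr_eq0.
    rewrite -scaleA; apply: (scale_sym bp0 _).
    by rewrite -bME ME scaleA.
  (* The equality bM = aM with M = pB becomes bB = aB. *)
  have bE : scale b B = scale a B.
    have /(congr1 (scale p^-1)) : scale b M = scale a M by [].
    by rewrite ME !scaleA [_ * b * p]mulrAC [_ * a * p]mulrAC mulVf // !mul1r.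
  have [c Bc bac] : scale a B b by rewrite -bE; apply: scale_self.
  have [[_ Aa1 _]|Ma] := unit_or_nonunit Aa; last first.
    by rewrite -ME -bac mulrC; apply: Bc.
  have [d Bd abd] : scale b B a by rewrite bE; apply: scale_self.
  case: nub; split=> //; have -> : b^-1 = d * a^-1.
    by apply: (mulfI b0); rewrite mulrA abd !divff.
  by apply: (subringM rB) => //; apply: AB.
have arB : archimedean B.
  apply: (@dvr_archimedean _ B p) => //.
  - exact: domain_inW domA rB AB.
  - exact/AB/MA.
  - exact: (power_quotients_zero rA iM M1 piM Mp p0 rB AB fB).
have [RB|/existsNP[r /not_implyP[Rr nBr]]] := pselect (R `<=` B).
  left; have nR : nonzero R by exists 1; [apply: subring1|apply: oner_neq0].
  have [[y y0 RE]|[y y0 RE]] :=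
      piM R (subring_submodule rR AR) (fractionalS RB fB) nR.
    by left; apply: (scale_ring_eq rR rA y0).
  right; rewrite /=; apply: (scale_ring_eq rR rB (mulf_neq0 y0 p0)).
  by rewrite -scaleA -ME.
(* Dividing z by p first brings z r^-n into pB = M, hence into A. *)
right; apply/seteqP; split=> // z _; have [n Bzn] := arB r (z / p) nBr.
have r0 : r != 0 by apply/eqP => r0; apply: nBr; rewrite r0; apply: subring0.
rewrite -(divfK (expf_neq0 n r0) z); apply: subringM => //; last exact: subringX.
suff : M (z / r ^+ n) by move/MA/AR.
by rewrite ME; apply/(scaleP _ _ p0); rewrite mulrAC.
Qed.

(** A maximal ideal that is not principal, or is mA with m nonzero, is treated above;
    for m = 0 the ring A is the field itself. *)
Lemma local_MPD_overrings A : domain_in A -> is_local A -> MPD A ->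
  finite_set (overrings A).
Proof.
move=> domA locA mpdA; have [rA _] := domA.
have [Q mQ ipiQ] := MPD_pinched rA locA mpdA.
suff [B sB] : exists B, overrings A `<=` [set A; B; setT].
  apply: sub_finite_set sB _; rewrite !finite_setU.
  by split; [split|]; apply: finite_set1.
have [[m nuA]|npr] := pselect (exists m, nonunits A = scale m A); last first.
  have {}npr x : nonunits A <> scale x A by move=> nuA; apply: npr; exists x.
  apply: nonprincipal_nonunits_overrings => //.
  by rewrite -(MNI_nonunits rA locA mQ npr).
have [m0|/eqP m0] := pselect (m = 0); last first.
  exact: principal_nonunits_overrings domA m0 nuA (ideal_pinchedW ipiQ).
exists A => R [rR AR]; right; apply/seteqP; split=> // z _.
have unitA x : A x -> x != 0 -> A x^-1.
  move=> Ax x0; have [[]//|] := unit_or_nonunit Ax.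
  by rewrite nuA m0 => -[a _ xE]; move: x0; rewrite -xE mul0r eqxx.
have [_ fA] := domA; have [a [b [Aa Ab b0 ->]]] := fA z.
by apply: AR; apply: subringM => //; apply: unitA.
Qed.

End LocalMPD.

(** * Ideals disjoint from a set *)

Section Global.

Variable K : fieldType.
Implicit Types D I J M N P Q R S W : set K.

(** For S = {1} this yields maximal ideals, and for a multiplicative set S it
    yields prime ideals. *)
Lemma maximal_disjoint_ideal D I S : is_ideal D I -> (forall x, I x -> ~ S x) ->
  exists J, [/\ is_ideal D J, I `<=` J, forall x, J x -> ~ S x &
    forall J', is_ideal D J' -> J `<=` J' -> (forall x, J' x -> ~ S x) -> J' = J].
Proof.
move=> iI IS.
pose good X := [/\ is_ideal D X, I `<=` X & forall x, X x -> ~ S x].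
(* The union of the empty chain has to be admitted as well. *)
have [F FP totF|J [[J0|[iJ IJ JS]] maxJ]] :=
    @Zorn_bigcup K [set X | X = set0 \/ good X].
- have goodF X x : F X -> X x -> good X by move=> /FP[->|].
  have [[X FX [x Xx]]|nF] := pselect (exists2 X, F X & exists x, X x); last first.
    left; apply/seteqP; split=> // x [X FX Xx]; apply: nF; exists X => //.
    by exists x.
  right; have [[XD X0 XD' XM] IX XS] := goodF X x FX Xx.
  split; last by move=> y [Y FY Yy]; have [_ _] := goodF Y y FY Yy; apply.
    split.
    + by move=> y [Y FY Yy]; have [[YD _ _ _] _ _] := goodF Y y FY Yy; apply: YD.
    + by exists X.
    + move=> y z [Y FY Yy] [Z FZ Zz].
      have [[_ _ YA _] _ _] := goodF Y y FY Yy.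
      have [[_ _ ZA _] _ _] := goodF Z z FZ Zz.
      have [YZ|ZY] := totF Y Z FY FZ.
        by exists Z => //; apply: ZA => //; apply: YZ.
      by exists Y => //; apply: YA => //; apply: ZY.
    + move=> a y Da [Y FY Yy]; have [[_ _ _ YM] _ _] := goodF Y y FY Yy.
      by exists Y => //; apply: YM.
  by move=> y Iy; exists X => //; apply: IX.
- have I0 : I 0 by case: iI.
  case: (maxJ I); last by right; split.
  by rewrite J0; split=> [//|/(_ 0 I0)].
- exists J; split=> // J' iJ' JJ' J'S; apply: contrapT => J'J.
  apply: (maxJ J'); last by right; split=> // x /IJ/JJ'.
  by split=> // J'J2; apply: J'J; apply/seteqP.
Qed.

Lemma proper_ideal_maximal D I : is_subring D -> is_ideal D I -> ~ I 1 ->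
  exists2 M, Max D M & I `<=` M.
Proof.
move=> rD iI I1.
have [x Ix x1|M [iM IM M1 maxM]] := @maximal_disjoint_ideal D I [set 1] iI.
  by apply: I1; rewrite -x1.
exists M => //; split=> // [MD|J iJ MJ].
  by apply: (M1 1) => //; rewrite MD; apply: subring1.
have [J1|J1] := pselect (J 1); first by right; apply: ideal_eq_ring.
by left; apply: maxM => // x Jx x1; apply: J1; rewrite -x1.
Qed.

Definition ideal_adjoin D J x : set K :=
  [set z | exists u d, [/\ J u, D d & z = u + x * d]].

Lemma ideal_adjoinP D J x : is_subring D -> is_ideal D J -> D x ->
  [/\ is_ideal D (ideal_adjoin D J x), J `<=` ideal_adjoin D J x
    & ideal_adjoin D J x x].
Proof.
move=> rD [JD J0 JA JM] Dx; have [D0 D1] := (subring0 rD, subring1 rD).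
split=> [|u Ju|]; last 2 first.
- by exists u, 0; split; rewrite // mulr0 addr0.
- by exists 0, 1; split; rewrite // mulr1 add0r.
split=> [_ [u [d [Ju Dd ->]]]| |_ _ [u [d [Ju Dd ->]]] [v [e [Jv De ->]]]|
    a _ Da [u [d [Ju Dd ->]]]].
- by apply: subringD; [|apply: JD|apply: subringM].
- by exists 0, 0; split; rewrite // mulr0 addr0.
- by exists (u + v), (d + e); split; [apply: JA|apply: subringD|ring].
- by exists (a * u), (a * d); split; [apply: JM|apply: subringM|ring].
Qed.

(** If neither x nor y is in J, then J + xD and J + yD both meet S; the product of
    two such elements of S lies in J + xyD. *)
Lemma maximal_disjoint_prime D J S : is_subring D -> is_ideal D J -> S 1 ->
  (forall x y, S x -> S y -> S (x * y)) -> (forall x, J x -> ~ S x) ->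
  (forall J', is_ideal D J' -> J `<=` J' -> (forall x, J' x -> ~ S x) -> J' = J) ->
  is_prime D J.
Proof.
move=> rD iJ S1 SM JS maxJ; have [JD J0 JA JM] := iJ.
split=> // [JE|x y Dx Dy Jxy].
  by apply: (JS 1) => //; rewrite JE; apply: subring1.
have meets z : D z -> ~ J z -> exists u d, [/\ J u, D d & S (u + z * d)].
  move=> Dz nJz; have [iJz JJz Jzz] := ideal_adjoinP rD iJ Dz.
  apply: contrapT => nS; apply: nJz; rewrite -(maxJ _ iJz JJz) //.
  by move=> _ [u [d [Ju Dd ->]]] Sud; apply: nS; exists u, d.
apply: contrapT => /not_orP[/(meets x Dx)[u [d [Ju Dd Sx]]]].
move=> /(meets y Dy)[v [e [Jv De Sy]]].
apply: JS (SM _ _ Sx Sy).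
have -> : (u + x * d) * (v + y * e) = (v + y * e) * u + x * d * v + d * e * (x * y).
  by ring.
apply: (JA); last by apply: (JM) => //; apply: subringM.
apply: JA; apply: JM => //; last exact: subringM.
by apply: subringD; [|apply: JD|apply: subringM].
Qed.

Lemma maximal_prime D M : is_subring D -> Max D M -> is_prime D M.
Proof.
move=> rD [iM MD maxM]; apply: (@maximal_disjoint_prime _ _ [set 1]) => //.
- by move=> _ _ -> ->; rewrite /= mulr1.
- by move=> x Mx x1; apply: MD; apply: ideal_eq_ring => //; rewrite -x1.
- move=> J iJ MJ J1; have [//|JD] := maxM J iJ MJ.
  by case: (J1 1) => //; rewrite JD; apply: subring1.
Qed.

(** * Localization at a prime ideal *)

Lemma prime1 D P : is_prime D P -> ~ P 1.
Proof. by move=> [iP PD _] P1; apply: PD; apply: ideal_eq_ring. Qed.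

Lemma prime_neq0 D P s : is_prime D P -> ~ P s -> s != 0.
Proof. by move=> [[_ P0 _ _] _ _] nPs; apply/eqP => s0; apply: nPs; rewrite s0. Qed.

Lemma primeM D P s t : is_prime D P -> D s -> D t ->
  ~ P s -> ~ P t -> ~ P (s * t).
Proof. by move=> [_ _ PM] Ds Dt nPs nPt /(PM _ _ Ds Dt)[]. Qed.

Lemma localization_sub D P : is_subring D -> is_prime D P -> D `<=` localization D P.
Proof.
move=> rD pP a Da; exists a, 1; rewrite divr1; split=> //; first exact: subring1.
exact: prime1 pP.
Qed.

Lemma localization_domain D P : domain_in D -> is_prime D P ->
  domain_in (localization D P).
Proof.
move=> domD pP; have [rD _] := domD; have D1 := subring1 rD.
apply: (domain_inW domD); last exact: localization_sub.
have n0 s : ~ P s -> s != 0 by apply: prime_neq0 pP.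
apply/is_subringP; split=> [|_ _ [a [s [Da Ds Ps ->]]] [b [t [Db Dt Pt ->]]]|
    _ _ [a [s [Da Ds Ps ->]]] [b [t [Db Dt Pt ->]]]].
- exact: localization_sub.
- exists (a * t - b * s), (s * t); split.
  + by apply: subringB => //; apply: subringM.
  + exact: subringM.
  + exact: primeM pP Ds Dt Ps Pt.
  + by field; rewrite !n0.
- exists (a * b), (s * t); split.
  + exact: subringM.
  + exact: subringM.
  + exact: primeM pP Ds Dt Ps Pt.
  + by field; rewrite !n0.
Qed.

(** a/s with s outside P is a unit exactly when a is outside P. *)
Lemma localization_nonunits D P x : is_subring D -> is_prime D P ->
  nonunits (localization D P) x <->
  exists a s, [/\ P a, D s, ~ P s & x = a / s].
Proof.
move=> rD pP; have n0 s : ~ P s -> s != 0 by apply: prime_neq0 pP.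
have [[PD P0 PA PM] _ _] := pP.
split=> [[[a [s [Da Ds Ps ->]]] nu]|[a [s [Pa Ds Ps ->]]]].
  exists a, s; split=> //; apply: contrapT => Pa; apply: nu; split.
  - by exists a, s.
  - by exists s, a; rewrite invfM invrK mulrC.
  - by rewrite mulf_neq0 ?invr_eq0 ?n0.
split; first by exists a, s; split=> //; apply: PD.
move=> [_ [b [t [Db Dt Pt asE]]]]; rewrite mulf_eq0 negb_or => /andP[a0 s0].
apply: (primeM pP Ds Dt Ps Pt); have -> : s * t = b * a.
  have -> : s = b / t * a by rewrite -asE invfM invrK mulrC mulrA mulfV ?mul1r.
  by field; apply: n0.
exact: PM.
Qed.

Lemma localization_local D P : is_subring D -> is_prime D P ->
  is_local (localization D P).
Proof.
move=> rD pP; have n0 s : ~ P s -> s != 0 by apply: prime_neq0 pP.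
have [[PD P0 PA PM] _ _] := pP.
have nuP x := localization_nonunits x rD pP.
split; first by move=> x [].
- by apply/nuP; exists 0, 1; rewrite mul0r; split=> //; [apply: subring1|apply: prime1 pP].
- move=> _ _ /nuP[a [s [Pa Ds Ps ->]]] /nuP[b [t [Pb Dt Pt ->]]]; apply/nuP.
  exists (t * a + s * b), (s * t); split.
  + by apply: PA; apply: PM.
  + exact: subringM.
  + exact: primeM pP Ds Dt Ps Pt.
  + by field; rewrite !n0.
- move=> _ _ [b [t [Db Dt Pt ->]]] /nuP[a [s [Pa Ds Ps ->]]]; apply/nuP.
  exists (b * a), (t * s); split.
  + exact: PM.
  + exact: subringM.
  + exact: primeM pP Dt Ds Pt Ps.
  + by field; rewrite !n0.
Qed.

(** An element of P has no inverse in D_P, so P can be read off D_P. *)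
Lemma localization_inj D P x : is_subring D -> is_prime D P ->
  P x <-> D x /\ (x = 0 \/ ~ localization D P x^-1).
Proof.
move=> rD pP; have [[PD P0 PA PM] _ _] := pP.
split=> [Px|[Dx [->//|nDx]]]; last first.
  apply: contrapT => nPx; apply: nDx; exists 1, x; split=> //; first exact: subring1.
  by rewrite mul1r.
split; first exact: PD.
have [x0|/eqP x0] := pselect (x = 0); [by left|right=> -[a [s [Da Ds Ps xE]]]].
have s0 := prime_neq0 pP Ps; apply: Ps; have -> : s = a * x.
  have -> : a = x^-1 * s by rewrite xE divfK.
  by rewrite mulrAC mulVf ?mul1r.
exact: PM.
Qed.

Lemma Spec_finite D : domain_in D -> finite_set (overrings D) -> finite_set (Spec D).
Proof.
move=> domD; have [rD _] := domD.
move=> /(finite_image (fun B => [set x | D x /\ (x = 0 \/ ~ B x^-1)])).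
apply: sub_finite_set => P pP; exists (localization D P).
  by split; [case: (localization_domain domD pP)|apply: localization_sub].
by apply/seteqP; split=> x; rewrite /= -(localization_inj x rD pP).
Qed.

(** * Overrings and their localizations *)

(** This plays the role of a finite product of the sets F i: an overring is the
    intersection of its localizations, so it suffices to count intersections. *)
Lemma finite_bigcap_choices (I : eqType) (T : Type) (s : seq I)
    (F : I -> set (set T)) : (forall i, i \in s -> finite_set (F i)) ->
  finite_set [set X | exists2 f : I -> set T, forall i, i \in s -> F i (f i)
                    & X = \bigcap_(i in [set` s]) f i].
Proof.
elim: s => [_|i s IHs finF].
  apply: sub_finite_set (finite_set1 setT) => X [f _ ->] /=.
  by apply/seteqP; split=> // x _ j; rewrite /= in_nil.
have finFi : finite_set (F i) by apply: finF; rewrite mem_head.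
have {}/IHs IHs j : j \in s -> finite_set (F j).
  by move=> js; apply: finF; rewrite inE js orbT.
apply: sub_finite_set (finite_image2 setI finFi IHs) => X [f Ff ->].
exists (f i); first by apply: Ff; rewrite mem_head.
exists (\bigcap_(j in [set` s]) f j).
  by exists f => // j js; apply: Ff; rewrite inE js orbT.
apply/seteqP; split=> [x [fix_ fsx] j|x fx]; rewrite /=.
  by rewrite inE => /predU1P[->//|/fsx].
by split=> [|j js]; apply: fx; rewrite /= ?mem_head // inE js orbT.
Qed.

(** The localization of R at M, that is, the ring RD_M. *)
Definition local_overring D R M : set K :=
  [set x | exists s, [/\ D s, ~ M s & R (s * x)]].

Lemma local_overringP D R M : is_subring D -> is_prime D M -> overrings D R ->
  overrings (localization D M) (local_overring D R M).
Proof.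
move=> rD pM [rR DR]; split; last first.
  move=> _ [a [s [Da Ds Ms ->]]]; exists s; split=> //.
  by rewrite mulrC divfK ?(prime_neq0 pM) //; apply: DR.
apply/is_subringP; split=> [|x y [s [Ds Ms Rx]] [t [Dt Mt Ry]]|
    x y [s [Ds Ms Rx]] [t [Dt Mt Ry]]].
- exists 1; split; rewrite ?mulr1; [exact: subring1| |exact: subring1].
  exact: prime1 pM.
- exists (s * t); split; [exact: subringM|exact: primeM pM Ds Dt Ms Mt|].
  have -> : s * t * (x - y) = t * (s * x) - s * (t * y) by ring.
  by apply: subringB => //; apply: subringM => //; apply: DR.
- exists (s * t); split; [exact: subringM|exact: primeM pM Ds Dt Ms Mt|].
  have -> : s * t * (x * y) = s * x * (t * y) by ring.
  exact: subringM.
Qed.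

(** The denominators s with sx in R form an ideal; if x lies in every RD_M, it is
    contained in no maximal ideal. *)
Lemma overring_local_global D R : is_subring D -> overrings D R ->
  R = \bigcap_(M in Max D) local_overring D R M.
Proof.
move=> rD [rR DR]; have D1 := subring1 rD.
apply/seteqP; split=> [x Rx M maxM|x locx].
  exists 1; rewrite mul1r; split=> //.
  by apply: prime1; apply: maximal_prime maxM.
pose I := [set s | D s /\ R (s * x)].
have iI : is_ideal D I.
  split=> [s []//||s t [Ds Rs] [Dt Rt]|a s Da [Ds Rs]].
  - by split; rewrite ?mul0r; apply: subring0.
  - by split; rewrite ?mulrDl; apply: subringD.
  - by split; rewrite -?mulrA; apply: subringM => //; apply: DR.
have [[_]|/(proper_ideal_maximal rD iI)[M maxM IM]] := pselect (I 1).
  by rewrite mul1r.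
by have [s [Ds Ms Rs]] := locx M maxM; case: Ms; apply: IM.
Qed.

Lemma overrings_finite D : domain_in D -> GMPD D -> finite_set (Max D) ->
  finite_set (overrings D).
Proof.
move=> domD [_ mpdD] finMax; have [rD _] := domD.
have [s MaxE] := (finite_seqP (Max D)).1 finMax.
have finloc M : M \in s -> finite_set (overrings (localization D M)).
  move=> sM; have maxM : Max D M by rewrite MaxE.
  have pM := maximal_prime rD maxM.
  apply: local_MPD_overrings; last exact: mpdD.
    exact: localization_domain.
  exact: localization_local.
apply: sub_finite_set (finite_bigcap_choices finloc) => R oR.
exists (local_overring D R); last by rewrite -MaxE; apply: overring_local_global.
move=> M sM; apply: local_overringP => //; apply: maximal_prime => //.
by rewrite MaxE.
Qed.

(** * Independence of the maximal ideals of an h-local domain *)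

(** Otherwise a prime ideal containing a would avoid every product st, hence be
    contained in both M and N. *)
Lemma h_local_separation D M N a : is_subring D -> h_local D ->
  Max D M -> Max D N -> M <> N -> D a -> a != 0 ->
  exists s t, [/\ D s, D t, ~ N s, ~ M t & exists2 d, D d & s * t = a * d].
Proof.
move=> rD [_ uniqMax] maxM maxN MN Da a0; have D1 := subring1 rD.
have [pM pN] := (maximal_prime rD maxM, maximal_prime rD maxN).
pose S := [set x | exists s t, [/\ D s, D t, ~ N s, ~ M t & x = s * t]].
apply: contrapT => nst.
have iaD := principal_ideal rD Da.
have aDS x : scale a D x -> ~ S x.
  move=> [d Dd xE] [s [t [Ds Dt Ns Mt xst]]]; apply: nst; exists s, t; split=> //.
  by exists d => //; rewrite -xst.
have [P [iP aP PS maxP]] := maximal_disjoint_ideal iaD aDS.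
have [N1 M1] := (prime1 pN, prime1 pM).
have pP : is_prime D P.
  apply: (maximal_disjoint_prime rD iP _ _ PS maxP).
    by exists 1, 1; split; rewrite ?mulr1.
  move=> _ _ [s [t [Ds Dt Ns Mt ->]]] [s' [t' [Ds' Dt' Ns' Mt' ->]]].
  exists (s * s'), (t * t'); split; [exact: subringM|exact: subringM| | |ring].
    exact: primeM pN Ds Ds' Ns Ns'.
  exact: primeM pM Dt Dt' Mt Mt'.
have Pa : P a by apply: aP; exists 1; rewrite ?mulr1.
have Pn0 : P <> [set 0] by move=> P0; rewrite P0 in Pa; rewrite Pa eqxx in a0.
have [PD _ _ _] := iP.
have [Q [_ uQ]] := uniqMax P pP Pn0.
have PM : P `<=` M.
  move=> x Px; apply: contrapT => Mx; apply: (PS x Px).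
  by exists 1, x; rewrite mul1r; split=> //; apply: PD.
have PN : P `<=` N.
  move=> x Px; apply: contrapT => Nx; apply: (PS x Px).
  by exists x, 1; rewrite mulr1; split=> //; apply: PD.
by apply: MN; rewrite -(uQ M) // -(uQ N).
Qed.

(** For a nonzero a in M, only finitely many maximal ideals N contain a, and
    a product of denominators t outside M makes t/a belong to all the
    D_N for N other than M. *)
Lemma h_local_independent D M : is_subring D -> h_local D -> Max D M ->
  M <> [set 0] ->
  exists y, ~ localization D M y /\
    forall N, Max D N -> N <> M -> localization D N y.
Proof.
move=> rD hD maxM Mn0; have [finMax _] := hD; have pM := maximal_prime rD maxM.
have D1 := subring1 rD.
have [iM _ _] := maxM; have [MD _ _ MM] := iM.
have [a Ma a0] := ideal_nonzero iM Mn0; have Da := MD _ Ma.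
have iaD := principal_ideal rD Da.
have aDa : scale a D a by exists 1; rewrite ?mulr1.
have /finMax/(_ _)/finite_seqP[|s sE] := iaD.
  by move=> aD0; rewrite aD0 in aDa; rewrite aDa eqxx in a0.
have [b [Db Mb bs]] : exists b, [/\ D b, ~ M b &
    forall N, N \in s -> N <> M -> localization D N (b / a)].
  have : {in s, forall N, Max D N}.
    by move=> N sN; have : [set` s] N by []; rewrite -sE => -[].
  elim: (s) => [_|N l IHl maxl]; first by exists 1; split=> //; apply: prime1 pM.
  have [|b [Db Mb bl]] := IHl.
    by move=> P lP; apply: maxl; rewrite inE lP orbT.
  have [NM|NM] := pselect (N = M).
    exists b; split=> // P; rewrite inE => /predU1P[->|]; [by []|exact: bl].
  have maxN : Max D N by apply: maxl; rewrite mem_head.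
  have MN : M <> N by move=> MN; apply: NM.
  have [r [t [Dr Dt Nr Mt [d Dd rtE]]]] :=
    h_local_separation rD hD maxM maxN MN Da a0.
  exists (b * t); split; [exact: subringM|exact: primeM pM Db Dt Mb Mt|].
  move=> P; rewrite inE => /predU1P[-> _|lP PM].
    exists (b * d), r; split=> //; first exact: subringM.
    have r0 := prime_neq0 (maximal_prime rD maxN) Nr.
    have tE : t = a * d / r by rewrite -rtE mulrAC divff ?mul1r.
    by rewrite tE; field; rewrite a0 r0.
  have [c [q [Dc Dq Pq baE]]] := bl P lP PM.
  by exists (c * t), q; split=> //; [apply: subringM|rewrite mulrAC baE mulrAC].
exists (b / a); split=> [[c [q [Dc Dq Mq bacq]]]|N maxN NM].
  apply: (primeM pM Db Dq Mb Mq); have -> : b * q = c * a.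
    have q0 := prime_neq0 pM Mq.
    by rewrite -[b](divfK a0) bacq mulrAC divfK.
  exact: MM.
have [sN|nsN] := pselect (N \in s); first exact: bs.
exists b, a; split=> // Na; apply: nsN.
have : [set` s] N.
  rewrite -sE; split=> // _ [d Dd <-]; rewrite mulrC.
  by have [[_ _ _ NM'] _ _] := maxN; apply: NM'.
by [].
Qed.

(** For distinct M_0, M_1, ..., the intersections of the D_{M_i} with i >= n
    form a strictly increasing chain. *)
Lemma finite_chains_finite_Max D : domain_in D -> h_local D ->
  (forall C : set (set K),
     C `<=` overrings D -> total_on C subset -> finite_set C) ->
  finite_set (Max D).
Proof.
move=> domD hD finC; have [rD _] := domD; apply: contrapT => /infiniteP/pcard_leP[M].
have maxM n : Max D (M n) by apply: funS.
have injM i j : M i = M j -> i = j by apply: inj; rewrite inE.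
have Mn0 n : M n <> [set 0].
  move=> M0; have [iM1 M1D _] := maxM n.+1; have [_ _ /(_ _ iM1) maxMn] := maxM n.
  have Mnn1 : M n `<=` M n.+1 by move=> x; rewrite M0 => ->; case: iM1.
  by have [/injM/eqP|//] := maxMn Mnn1; rewrite gtn_eqF.
pose E n := \bigcap_(i in [set i | (n <= i)%N]) localization D (M i).
have leE i j : (i <= j)%N -> E i `<=` E j.
  by move=> ij x Ex k jk; apply: Ex; apply: leq_trans jk.
have ltE i j : (i < j)%N -> E i <> E j.
  move=> ij Eij; have [y [My Ny]] := h_local_independent rD hD (maxM i) (Mn0 i).
  apply: My; have : E j y.
    move=> k jk; apply: Ny => // /injM ki; move: (leq_trans ij jk).
    by rewrite ki ltnn.
  by rewrite -Eij; apply; rewrite /=.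
have injE : {in [set: nat] &, injective E}.
  move=> i j _ _ Eij; have [ij|ji|//] := ltngtP i j.
    by case: (ltE _ _ ij).
  by case: (ltE _ _ ji).
apply: infinite_nat; have /(finite_preimage (f := E)) finE : finite_set (range E).
  apply: finC => [_ [n _ <-]|_ _ [i _ <-] [j _ <-]].
    have prM i := maximal_prime rD (maxM i).
    split; last by move=> x Dx i _; apply: localization_sub Dx.
    have rDM i : is_subring (localization D (M i)).
      by have [] := localization_domain domD (prM i).
    apply/is_subringP; split=> [i _|x y Ex Ey i ni|x y Ex Ey i ni].
    - exact: subring1.
    - by apply: subringB => //; [apply: Ex|apply: Ey].
    - by apply: subringM => //; [apply: Ex|apply: Ey].
  by have [/leE|/ltnW/leE] := leqP j i; [right|left].
apply: sub_finite_set (finE _) => [n _|i j _ _]; first by exists n.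
by apply: injE; rewrite inE.
Qed.

End Global.

Theorem proposition2 (K : fieldType) (D : set K)
    (domD : domain_in D) (gmpdD : GMPD D) :
  [<-> finite_set (overrings D);
       forall C : set (set K),
         C `<=` overrings D -> total_on C subset -> finite_set C;
       finite_set (Spec D);
       finite_set (Max D)].
Proof.
have [rD _] := domD; have [hD _] := gmpdD; tfae.
- by move=> finD C CD _; apply: sub_finite_set CD finD.
- move=> finC; apply: Spec_finite => //; apply: overrings_finite => //.
  exact: finite_chains_finite_Max.
- by apply: sub_finite_set => M; apply: maximal_prime.
- exact: overrings_finite.
Qed.
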